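(* Consider the generalized inversion and descent statistics on the symmetric groups $S_n$. Let $d_1=d_1(n)\in\{1,\dots,n-1\}$ satisfy $d_1=o\bigl(n^{1/3}(\log(n^{4/3}))^{-7/3}\bigr)$ and let $d_2=d_2(n)\in\{1,\dots,n-1\}$ be arbitrary. For the limiting correlation $$\rho=\lim_{n\to\infty}\mathrm{Corr}\bigl(X_{\mathrm{inv}}^{(d_1)},X_{\mathrm{des}}^{(d_2)}\bigr)$$ the following holds: (a) If $d_1<d_2$ for all $n$, then $\rho$ exists and $\rho=0$. (b) If $d_1\ge d_2$ for all $n$ and $d_1$ is eventually constant, then $\rho$ exists and $\rho=1/\sqrt{d_1}$ (with $d_1$ denoting the eventual constant value). If $d_1\ge d_2$ for all $n$ and $d_1$ is bounded but has multiple accumulation points, then the limit $\rho$ does not exist. (c) If $d_1\ge d_2$ for all $n$ and $d_1\to\infty$ as $n\to\infty$, then $\rho$ exists and $\rho=0$.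
   Context: Let $Z_1,\dots,Z_n$ be i.i.d. uniform on $(0,1)$. For $d\in\{1,\dots,n-1\}$, on the symmetric group $S_n$ define $$X_{\mathrm{inv}}^{(d)}=\sum_{1\le i<j\le n,\ j-i\le d}\mathbf 1\{Z_i>Z_j\},\qquad X_{\mathrm{des}}^{(d)}=\sum_{i=1}^{n-d}\mathbf 1\{Z_i>Z_{i+d}\}.$$ Both statistics are built from the same $Z_1,\dots,Z_n$. $\mathrm{Corr}(X,Y)=\mathrm{Cov}(X,Y)/\sqrt{\mathrm{Var}(X)\mathrm{Var}(Y)}$. *)

(* Defs.v *)
From HB Require Import structures.
From mathcomp Require Import all_boot all_order all_algebra.
From mathcomp Require Import all_classical all_reals all_analysis.

Set Implicit Arguments.
Unset Strict Implicit.
Unset Printing Implicit Defensive.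

Import Order.TTheory GRing.Theory Num.Theory.
Import numFieldNormedType.Exports.

Local Open Scope classical_set_scope.
Local Open Scope ring_scope.

Definition mutually_independent (R : realType) (d : measure_display)
    (T : measurableType d) (P : probability T R) (I : finType)
    (X : I -> {RV P >-> R}) : Prop :=
  forall (J : {set I}) (A : I -> set R), (forall i, measurable (A i)) ->
    P (\bigcap_(i in [set` J]) X i @^-1` A i) =
    (\prod_(i in J) P (X i @^-1` A i))%E.

(* The law is compared with the uniform one on measurable sets only: off the
   sigma-algebra the values of the two set functions are meaningless. The
   library's uniform law lives on [0, 1]; it is the one on (0, 1), the two
   endpoints being null. *)
Definition uniform01 (R : realType) (d : measure_display)
    (T : measurableType d) (P : probability T R) (X : {RV P >-> R}) : Prop :=
  forall A : set R, measurable A ->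
    distribution P X A = uniform_prob (@ltr01 R) A.

Definition iid_uniform01 (R : realType) (d : measure_display)
    (T : measurableType d) (P : probability T R) (I : finType)
    (X : I -> {RV P >-> R}) : Prop :=
  mutually_independent X /\ forall i, uniform01 (X i).

(* The indices 1, ..., n are represented by 'I_n = {0, ..., n-1}; only
   differences of indices matter. *)
Definition X_inv (R : realType) (d : measure_display) (T : measurableType d)
    (P : probability T R) (n : nat) (Z : 'I_n -> {RV P >-> R}) (k : nat) :
    T -> R :=
  fun t => \sum_(i < n) \sum_(j < n | ((i < j) && (j - i <= k))%N)
    \1_[set s | Z i s > Z j s] t.

(* The inner sum has the single term j = i + k if i + k < n, and is empty
   otherwise. *)
Definition X_des (R : realType) (d : measure_display) (T : measurableType d)
    (P : probability T R) (n : nat) (Z : 'I_n -> {RV P >-> R}) (k : nat) :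
    T -> R :=
  fun t => \sum_(i < n) \sum_(j < n | (j == i + k :> nat)%N)
    \1_[set s | Z i s > Z j s] t.

Definition Corr (R : realType) (d : measure_display) (T : measurableType d)
    (P : probability T R) (X Y : T -> R) : R :=
  fine (covariance P X Y) / Num.sqrt (fine 'V_P[X] * fine 'V_P[Y]).

(* Main.v *)
(* Write I_ij for the indicator of {Z_i > Z_j}.  For i < j and k < l,
   12 Cov(I_ij, I_kl) = [(i,j) = (k,l)] + <e_i - e_j, e_k - e_l>.  Hence, for
   edge sets E and F on {0, ..., n-1} with all edges increasing,
   12 Cov(X_E, X_F) = #(E /\ F) + sum_v D_E(v) D_F(v), where D(v) is the
   out-degree minus the in-degree of v.  With k = d1 and m = d2, the degree
   difference of X_inv vanishes except within k of the two ends, so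
   12 Var(X_inv) = n k + O(k^3), and if m <= k also 12 Var(X_des) = n + O(k) and
   12 Cov = n + O(k^2); as k^3 = o(n), Corr * sqrt k tends to 1.  If k < m then
   E and F are disjoint and Cauchy-Schwarz on the degree sums gives
   Corr^2 <= sum_v D_E(v)^2 / (12 Var(X_inv)) = O(k^2 / n). *)
Require Import Defs.
From HB Require Import structures.
From mathcomp Require Import all_boot all_order all_algebra.
From mathcomp Require Import all_classical all_reals all_analysis.
From mathcomp Require Import measurable_realfun ring lra zify.

Set Implicit Arguments.
Unset Strict Implicit.
Unset Printing Implicit Defensive.

Import Order.TTheory GRing.Theory Num.Theory.
Import numFieldNormedType.Exports.

Local Open Scope classical_set_scope.
Local Open Scope ring_scope.

(** * Independence and order events *)

(** Both sides are measures in [C] that agree on rectangles, so uniqueness of the product measure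
    applies. The event [F] is carried along so that the lemma can be iterated, freeing one pair of
    variables while others stay fixed. *)
Lemma prob_prod_law (R : realType) (d d1 d2 : measure_display)
    (T : measurableType d) (T1 : measurableType d1) (T2 : measurableType d2)
    (P : probability T R) (m1 : probability T1 R) (m2 : probability T2 R)
    (F : set T) (X : T -> T1) (Y : T -> T2) :
  measurable F -> measurable_fun setT X -> measurable_fun setT Y ->
  (forall A B, measurable A -> measurable B ->
    P (F `&` (X @^-1` A `&` Y @^-1` B)) = (P F * (m1 A * m2 B))%E) ->
  forall C, measurable C ->
    P (F `&` [set t | C (X t, Y t)]) = (P F * (m1 \x m2) C)%E.
Proof.
move=> mF mX mY indep C mC.
have k0 : 0 <= fine (P F) by rewrite fine_ge0.
pose k := NngNum k0.
have PFk : P F = (k%:num)%:E by rewrite /k /= fineK// fin_num_measure.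
have mXY : measurable_fun setT (fun t => (X t, Y t)).
  exact: measurable_fun_pair.
(* Restricting [P] to [F] before the pushforward gives total mass [P F]; on the product side this
   factor is absorbed by scaling [m1]. *)
pose m0 : {measure set (T1 * T2) -> \bar R} :=
  pushforward (mrestr P mF) (fun t => (X t, Y t)).
pose m' := m0 mXY.
have m'E D : m' D = P (F `&` [set t | D (X t, Y t)]).
  by rewrite /m' /= /pushforward /mrestr setIC.
rewrite -m'E -(@product_measure_unique _ _ _ _ _ (mscale k m1) m2 m')//.
  by rewrite /product_measure1 ge0_integral_mscale// ?PFk//;
    exact: measurable_fun_xsection.
by move=> A B mA mB; rewrite m'E indep// PFk /mscale/= muleA.
Qed.

Section measurable_comparison.
Context (R : realType) (d : measure_display) (T : measurableType d).
Context (f g : T -> R).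
Hypotheses (mf : measurable_fun setT f) (mg : measurable_fun setT g).

Lemma measurable_set_ltr : measurable [set t | f t < g t].
Proof.
by have := measurable_fun_ltr mf mg measurableT (Y := [set true]) I; rewrite setTI.
Qed.

Lemma measurable_set_eqr : measurable [set t | f t = g t].
Proof.
have := measurable_fun_eqr mf mg measurableT (Y := [set true]) I.
by rewrite setTI; congr measurable; apply/seteqP; split=> t /= /eqP.
Qed.

End measurable_comparison.

Section iid.
Context (R : realType) (d : measure_display) (T : measurableType d).
Context (P : probability T R) (n : nat) (Z : 'I_n -> {RV P >-> R}).
Context (U : probability R R).
Hypothesis Zindep : mutually_independent Z.
Hypothesis Zlaw : forall i A, measurable A -> P (Z i @^-1` A) = U A.

Lemma iid_box (s : seq 'I_n) (A : 'I_n -> set R) : uniq s ->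
  (forall i, measurable (A i)) ->
  P (\big[setI/setT]_(i <- s) (Z i @^-1` A i)) = (\prod_(i <- s) U (A i))%E.
Proof.
move=> us mA.
have := Zindep [set i in s] mA.
rewrite -bigcap_seq (_ : [set` [set i in s]] = [set` s]); last first.
  by apply/seteqP; split=> i /=; rewrite inE.
move=> ->; rewrite (eq_bigl (mem s)); last by move=> i; rewrite inE.
rewrite big_uniq//=; apply: eq_bigr => i _.
exact: Zlaw.
Qed.

Lemma iid_box2 i j (A B : set R) : i != j -> measurable A -> measurable B ->
  P (Z i @^-1` A `&` Z j @^-1` B) = (U A * U B)%E.
Proof.
move=> ij mA mB; pose F k := if k == i then A else B.
have mF k : measurable (F k) by rewrite /F; case: ifP.
have us : uniq [:: i; j] by rewrite /= inE ij.
have := iid_box us mF.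
by rewrite !big_cons !big_nil setIT mule1 /F eqxx eq_sym (negbTE ij).
Qed.

Lemma iid_box3 i j k (A B C : set R) : uniq [:: i; j; k] ->
  measurable A -> measurable B -> measurable C ->
  P (Z i @^-1` A `&` (Z j @^-1` B `&` Z k @^-1` C)) = (U A * (U B * U C))%E.
Proof.
move=> us mA mB mC.
pose F l := if l == i then A else if l == j then B else C.
have mF l : measurable (F l) by rewrite /F; do 2 case: ifP => //.
have := iid_box us mF.
move: us => /=; rewrite !inE !negb_or andbT => /andP[/andP[ij ik] jk].
rewrite !big_cons !big_nil setIT mule1 /F !eqxx [j == i]eq_sym [k == i]eq_sym.
by rewrite [k == j]eq_sym (negbTE ij) (negbTE ik) (negbTE jk).
Qed.

Lemma iid_box4 i j k l (A B C D : set R) : uniq [:: i; j; k; l] ->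
  measurable A -> measurable B -> measurable C -> measurable D ->
  P ((Z i @^-1` A `&` Z j @^-1` B) `&` (Z k @^-1` C `&` Z l @^-1` D)) =
  (U A * U B * (U C * U D))%E.
Proof.
move=> us mA mB mC mD.
pose F m := if m == i then A else if m == j then B else if m == k then C else D.
have mF m : measurable (F m) by rewrite /F; do 3 case: ifP => //.
have := iid_box us mF.
move: us => /=; rewrite !inE !negb_or andbT.
move=> /andP[/and3P[ij ik il] /andP[/andP[jk jl] kl]].
rewrite !big_cons !big_nil setIT mule1 /F !eqxx.
rewrite [j == i]eq_sym [k == i]eq_sym [l == i]eq_sym (negbTE ij) (negbTE ik).
rewrite (negbTE il) [k == j]eq_sym [l == j]eq_sym (negbTE jk) (negbTE jl).
by rewrite [l == k]eq_sym (negbTE kl) setIA muleA.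
Qed.

Lemma iid_law2 i j (C : set (R * R)) : i != j -> measurable C ->
  P [set t | C (Z i t, Z j t)] = (U \x U)%E C.
Proof.
move=> ij mC; rewrite -[LHS](congr1 P (setTI _)).
rewrite (@prob_prod_law _ _ _ _ _ _ _ P U U)//.
  by rewrite probability_setT mul1e.
by move=> A B mA mB; rewrite setTI probability_setT mul1e iid_box2.
Qed.

Lemma iid_law3 i j k (C : set (R * (R * R))) : uniq [:: i; j; k] ->
  measurable C ->
  P [set t | C (Z i t, (Z j t, Z k t))] = (U \x (U \x U))%E C.
Proof.
move=> us mC; rewrite -[LHS](congr1 P (setTI _)).
have mZi A : measurable A -> measurable (Z i @^-1` A).
  by move=> mA; exact: measurable_funPTI.
have jk : j != k by move: us => /= /and3P[_]; rewrite inE.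
rewrite (@prob_prod_law _ _ _ _ _ _ _ P U (U \x U)%E setT (Z i)
  (fun t => (Z j t, Z k t)))//; first by rewrite probability_setT mul1e.
  exact: measurable_fun_pair.
move=> A B mA mB; rewrite setTI probability_setT mul1e.
(* Second application, to the pair of [Z j] and [Z k], with the event on [Z i] in the role of
   [F]. *)
transitivity (P (Z i @^-1` A) * (U \x U)%E B)%E; last by rewrite Zlaw.
apply: prob_prod_law => //; first exact: mZi.
by move=> A' B' mA' mB'; rewrite iid_box3// Zlaw.
Qed.

(** Two applications of [prob_prod_law]: first [F] is the [D]-event and [Z i], [Z j] are freed; on
    the resulting rectangles [F] is the box of [Z i], [Z j] and [Z k], [Z l] are freed. *)
Lemma iid_law22 i j k l (C D : set (R * R)) : uniq [:: i; j; k; l] ->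
  measurable C -> measurable D ->
  P ([set t | C (Z i t, Z j t)] `&` [set t | D (Z k t, Z l t)]) =
  ((U \x U) C * (U \x U) D)%E.
Proof.
move=> us mC mD.
have mZ m A : measurable A -> measurable (Z m @^-1` A).
  by move=> mA; exact: measurable_funPTI.
have [ij kl] : i != j /\ k != l.
  move: us; rewrite /= !inE !negb_or andbT.
  by move=> /andP[/and3P[-> _ _] /andP[_ ->]].
have mkl : measurable [set t | D (Z k t, Z l t)].
  rewrite -[X in measurable X]setTI.
  exact: (measurable_fun_pair (measurable_funPT (Z k)) (measurable_funPT (Z l))).
rewrite setIC (@prob_prod_law _ _ _ _ _ _ _ P U U)//.
  by rewrite iid_law2// muleC.
move=> A B mA mB; rewrite setIC (@prob_prod_law _ _ _ _ _ _ _ P U U)//.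
- by rewrite iid_box2// iid_law2// muleC.
- by apply: measurableI; exact: mZ.
- by move=> A' B' mA' mB'; rewrite iid_box4// iid_box2.
Qed.

(** Absence of atoms excludes ties; exchangeability then determines every probability of order
    events below. *)
Hypothesis Uatomless : forall x, U [set x] = 0%E.

Let gt i j := [set t | Z i t > Z j t].

Let measurable_gtR : measurable [set p : R * R | p.1 > p.2].
Proof. exact: measurable_set_ltr measurable_snd measurable_fst. Qed.

Let measurable_gt i j : measurable (gt i j).
Proof. exact: measurable_set_ltr. Qed.

(** The diagonal is null for the product measure because each of its sections is a singleton. *)
Lemma iid_no_ties i j : i != j -> P [set t | Z i t = Z j t] = 0%E.
Proof.
move=> ij; have mD : measurable [set p : R * R | p.1 = p.2].
  exact: measurable_set_eqr measurable_fst measurable_snd.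
rewrite (iid_law2 ij mD) /product_measure1 integral0_eq// => x _ /=.
rewrite (_ : xsection _ x = [set x]) ?Uatomless//.
by apply/seteqP; split=> y; rewrite /xsection /= inE /= => ->.
Qed.

(** The two pieces are disjoint and miss only ties. This is the source of all linear relations
    between the probabilities [q]. *)
Lemma iid_split_gt (A : set T) i j : measurable A -> i != j ->
  P A = (P (A `&` gt i j) + P (A `&` gt j i))%E.
Proof.
move=> mA ij; rewrite -measureU//; try exact: measurableI; last first.
  apply/seteqP; split=> // t [[_ /= ji] [_ /= /lt_trans/(_ ji)]].
  by rewrite ltxx.
have mE : measurable [set t | Z i t = Z j t] by exact: measurable_set_eqr.
have mAE : measurable (A `&` [set t | Z i t = Z j t]) by exact: measurableI.
transitivity (P (A `&` gt i j `|` A `&` gt j i `|`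
    A `&` [set t | Z i t = Z j t])).
  congr (P _); apply/seteqP; split=> [t At|t [[[]|[]]|[]]]//.
  by case: (ltgtP (Z i t) (Z j t)) => h; [left; right|left; left|right].
apply: measureU0 => //.
  by apply: measurableU; exact: measurableI.
exact: subset_measure0 mE (@subIsetr _ _ _) (iid_no_ties ij).
Qed.

Let q i j k l : R := fine (P (gt i j `&` gt k l)).

Let fine_split (A : set T) i j : measurable A -> i != j ->
  fine (P A) = fine (P (A `&` gt i j)) + fine (P (A `&` gt j i)).
Proof.
by move=> mA ij; rewrite (iid_split_gt mA ij) fineD ?fin_num_measure//;
  apply: measurableI.
Qed.

(** Exchanging the two variables preserves the joint law, so the two halves of the split are
    equal. *)
Lemma iid_prob_gt i j : i != j -> fine (P (gt i j)) = 1 / 2.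
Proof.
move=> ij; have := fine_split measurableT ij.
rewrite probability_setT !setTI.
have -> : P (gt j i) = P (gt i j).
  rewrite (iid_law2 ij measurable_gtR).
  by rewrite eq_sym in ij; rewrite (iid_law2 ij measurable_gtR).
by move=> /=; lra.
Qed.

Lemma iid_prob_gt_disjoint i j k l : uniq [:: i; j; k; l] -> q i j k l = 1 / 4.
Proof.
move=> us; rewrite /q (iid_law22 us measurable_gtR measurable_gtR).
have [ij kl] : i != j /\ k != l.
  move: us; rewrite /= !inE !negb_or andbT.
  by move=> /andP[/and3P[-> _ _] /andP[_ ->]].
rewrite -{1}(iid_law2 ij measurable_gtR) -(iid_law2 kl measurable_gtR).
rewrite -[[set t | _]]/(gt i j) -[[set t | (_, _).1 > _]]/(gt k l).
rewrite fineM ?fin_num_measure// !iid_prob_gt//; lra.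
Qed.

Let tri (i j k : 'I_n) := uniq [:: i; j; k].

Let triP i j k : tri i j k -> [/\ i != j, i != k & j != k].
Proof. by rewrite /tri /= !inE negb_or !andbT => /andP[/andP[]]. Qed.

(** The probability that a given one of three variables is the largest, written through the product
    law so that it visibly does not depend on the indices. *)
Let max3 := fine ((U \x (U \x U))%E [set p : R * (R * R) | p.1 > p.2.1 /\ p.1 > p.2.2]).

Let qmax i j k : tri i j k -> q i j i k = max3.
Proof.
move=> us; rewrite /max3 -(iid_law3 us)//.
apply: measurableI; apply: measurable_set_ltr; try exact: measurable_fst.
  exact: measurableT_comp measurable_fst measurable_snd.
exact: measurableT_comp measurable_snd measurable_snd.
Qed.

Let q_sym i j k l : q i j k l = q k l i j.
Proof. by rewrite /q setIC. Qed.

Let q_split i j k l : i != j -> k != l -> q i j k l + q i j l k = 1 / 2.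
Proof. by move=> ij kl; rewrite /q -fine_split// iid_prob_gt. Qed.

(** Split the event [Z j > Z k] by comparing [Z i] with [Z j]: the other piece says that [Z j] is
    the largest. *)
Let qpath i j k : tri i j k -> q i j j k = 1 / 2 - max3.
Proof.
move=> /triP[ij ik jk]; rewrite -(@qmax j k i); last first.
  by rewrite /tri /= !inE negb_or jk [_ == i]eq_sym [k == i]eq_sym ij ik.
by rewrite -(@q_split j k i j)// [q i j j k]q_sym; lra.
Qed.

Let qmin i j k : tri i j k -> q i k j k = max3.
Proof.
move=> us; have [ij ik jk] := triP us.
have usk : tri i k j by rewrite /tri /= !inE negb_or ij ik eq_sym jk.
by have := @q_split i k j k ik jk; rewrite [q i k k j](qpath usk); lra.
Qed.

(* Compare Z_j and Z_k on the event that Z_i is the largest of the three. *)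
Let max3E i j k : tri i j k -> max3 = 1 / 3.
Proof.
move=> us; have [ij ik jk] := triP us.
have usk : tri i k j by rewrite /tri /= !inE negb_or ij ik eq_sym jk.
have := @fine_split (gt i j `&` gt i k) j k (measurableI _ _ _ _) jk.
rewrite -[LHS]/(q i j i k) (qmax us).
have -> : gt i j `&` gt i k `&` gt j k = gt i j `&` gt j k.
  apply/seteqP; split=> t /= [] => [[ti tk] tj|tij tjk]//.
  by split=> //; split=> //; exact: lt_trans tij.
have -> : gt i j `&` gt i k `&` gt k j = gt i k `&` gt k j.
  apply/seteqP; split=> t /= [] => [[ti tk] tj|tik tkj]//.
  by split=> //; split=> //; exact: lt_trans tik.
(* Both pieces are descending paths, so the relation becomes [max3 = 2 * (1 / 2 - max3)]. *)
rewrite -/(q i j j k) -/(q i k k j) (qpath us) (qpath usk).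
by move=> /(_ (@measurable_gt i j) (@measurable_gt i k)); lra.
Qed.

(** From the product 1/4 of the marginals, the joint probability is 1/2 for equal pairs, 1/3 for a
    shared index in the same role, 1/6 for one in opposite roles, and 1/4 for disjoint pairs. The
    two orders exclude a reversed pair. *)
Lemma iid_cov_gt (i j k l : 'I_n) : (i < j)%N -> (k < l)%N ->
  fine (P (gt i j `&` gt k l)) - fine (P (gt i j)) * fine (P (gt k l)) =
  (((i == k) && (j == l))%:R + (i == k)%:R + (j == l)%:R
    - (i == l)%:R - (j == k)%:R) / 12.
Proof.
move=> lt_ij lt_kl.
have ij : i != j by rewrite neq_ltn lt_ij.
have kl : k != l by rewrite neq_ltn lt_kl.
rewrite (iid_prob_gt ij) (iid_prob_gt kl) -/(q i j k l).
have [ik|ik] := eqVneq i k; have [jl|jl] := eqVneq j l.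
- subst k l; rewrite (negbTE ij) eq_sym (negbTE ij) /q setIid iid_prob_gt//=; lra.
- subst k; have us : tri i j l by rewrite /tri /= !inE negb_or ij kl jl.
  by rewrite (negbTE kl) [j == i]eq_sym (negbTE ij) (qmax us) (max3E us) /=; lra.
- subst l; have us : tri i k j by rewrite /tri /= !inE negb_or ij ik kl.
  by rewrite (negbTE ij) [j == k]eq_sym (negbTE kl) (qmin us) (max3E us) /=; lra.
have [il|il] := eqVneq i l; have [jk|jk] := eqVneq j k.
- by subst; move: (ltn_trans lt_ij lt_kl); rewrite ltnn.
- subst l; have us : tri k i j.
    by rewrite /tri /= !inE negb_or kl [k == j]eq_sym jk ij.
  by rewrite q_sym (qpath us) (max3E us) /=; lra.
- subst k; have us : tri i j l by rewrite /tri /= !inE negb_or ij il kl.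
  by rewrite (qpath us) (max3E us) /=; lra.
rewrite iid_prob_gt_disjoint; first by rewrite /=; lra.
by rewrite /= !inE !negb_or ij ik il jk jl kl.
Qed.

End iid.
Section uniform.
Context (R : realType) (d : measure_display) (T : measurableType d).
Context (P : probability T R) (n : nat) (Z : 'I_n -> {RV P >-> R}).
Hypothesis Ziid : iid_uniform01 Z.

Lemma uniform_cov_gt (i j k l : 'I_n) : (i < j)%N -> (k < l)%N ->
  fine (P ([set t | Z i t > Z j t] `&` [set t | Z k t > Z l t]))
    - fine (P [set t | Z i t > Z j t]) * fine (P [set t | Z k t > Z l t]) =
  (((i == k) && (j == l))%:R + (i == k)%:R + (j == l)%:R
    - (i == l)%:R - (j == k)%:R) / 12.
Proof.
(* The law of one variable serves as the common law; its points are null because the integral of the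
   uniform density over a point vanishes. *)
case: Ziid => indep unif; apply: (iid_cov_gt (U := distribution P (Z i))) => //.
  by move=> i' A mA; have := unif i' A mA; rewrite -(unif i A mA) /distribution.
move=> x; have := unif i [set x] (measurable_set1 x).
by rewrite /uniform_prob integral_set1.
Qed.

End uniform.

(** * Covariance of comparison statistics *)

Section indicator_combination.
Context (R : realType) (d : measure_display) (T : measurableType d).
Context (P : probability T R).

Lemma Lfun_indic (A : set T) : measurable A -> (\1_A : T -> R) \in Lfun P 1.
Proof.
by move=> mA; apply/Lfun1_integrable; apply: integrable_indic; rewrite ?fin_num_fun_lty.
Qed.

(** Integrability is proved along with the value, since additivity of the expectation requires it at
    each induction step. *)
Lemma expectation_sum_indic (I : finType) (c : I -> R) (A : I -> set T) :
  (forall i, measurable (A i)) ->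
  (fun t => \sum_i c i * \1_(A i) t) \in Lfun P 1 /\
  expectation P (fun t => \sum_i c i * \1_(A i) t) = (\sum_i c i * fine (P (A i)))%:E.
Proof.
move=> mA; elim: (index_enum I) => [|i s [IHl IHe]].
  split.
    rewrite (_ : (fun _ => _) = cst 0) ?Lfun_cst//.
    by apply/funext => t; rewrite big_nil.
  rewrite big_nil (_ : (fun _ => _) = cst 0) ?expectation_cst//.
  by apply/funext => t; rewrite big_nil.
have -> : (fun t => \sum_(j <- i :: s) c j * \1_(A j) t) =
    (c i \o* \1_(A i)) \+ (fun t => \sum_(j <- s) c j * \1_(A j) t).
  by apply/funext => t /=; rewrite big_cons mulrC.
have Ai := Lfun_indic (mA i).
have cAi : c i \o* (\1_(A i) : T -> R) \in Lfun P 1 by exact: Lfun_scale.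
split; first exact: rpredD.
rewrite expectationD// IHe expectationZl// expectation_indic// big_cons EFinD EFinM.
by rewrite fineK ?fin_num_measure.
Qed.

(** The product of the two sums is again a combination of indicators, of the intersections [A i]
    with [B j], so all three expectations come from [expectation_sum_indic]. *)
Lemma covariance_sum_indic (I J : finType) (a : I -> R) (b : J -> R)
    (A : I -> set T) (B : J -> set T) :
  (forall i, measurable (A i)) -> (forall j, measurable (B j)) ->
  covariance P (fun t => \sum_i a i * \1_(A i) t)
    (fun t => \sum_j b j * \1_(B j) t) =
  (\sum_i \sum_j a i * b j *
    (fine (P (A i `&` B j)) - fine (P (A i)) * fine (P (B j))))%:E.
Proof.
move=> mA mB.
have [lA eA] := expectation_sum_indic a mA.
have [lB eB] := expectation_sum_indic b mB.
have mAB (p : I * J) : measurable (A p.1 `&` B p.2) by exact: measurableI.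
have [lAB eAB] := expectation_sum_indic (fun p => a p.1 * b p.2) mAB.
have prodE : (fun t => \sum_i a i * \1_(A i) t) *
    (fun t => \sum_j b j * \1_(B j) t) =
    (fun t => \sum_p a p.1 * b p.2 * \1_(A p.1 `&` B p.2) t) :> (T -> R).
  apply/funext => t; rewrite /= /GRing.mul /= big_distrlr pair_bigA /=.
  by apply: eq_bigr => p _; rewrite indicI /= mulrACA.
rewrite covarianceE// prodE// eA eB eAB -EFinM -EFinB; congr (_%:E).
rewrite big_distrlr /= -(pair_bigA _ (fun i j => a i * b j * fine (P (A i `&` B j)))).
rewrite /= -sumrB; apply: eq_bigr => i _; rewrite -sumrB; apply: eq_bigr => j _.
by ring.
Qed.

End indicator_combination.

Section comparison_graph.
Context (R : realType) (n : nat).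
Implicit Types (e f : 'I_n -> 'I_n -> bool).

Definition edges e : R := \sum_i \sum_j (e i j)%:R.

Definition degree e (v : 'I_n) : R := \sum_j (e v j)%:R - \sum_i (e i v)%:R.

(* Twelve times the covariance of the statistics with edge sets e and f. *)
Definition comparison_cov e f : R :=
  edges (fun i j => e i j && f i j) + \sum_v degree e v * degree f v.

Lemma sum_eq_op (u : 'I_n) (F : 'I_n -> R) : \sum_v (u == v)%:R * F v = F u.
Proof.
rewrite (bigD1 u)//= eqxx mul1r big1 ?addr0// => v vu.
by rewrite eq_sym (negbTE vu) mul0r.
Qed.

Lemma degreeE e v :
  degree e v = \sum_p (e p.1 p.2)%:R * ((p.1 == v)%:R - (p.2 == v)%:R).
Proof.
rewrite -(pair_bigA _ (fun i j => (e i j)%:R * ((i == v)%:R - (j == v)%:R))) /=.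
under eq_bigr do under eq_bigr do rewrite mulrBr.
under eq_bigr do rewrite sumrB.
rewrite sumrB; congr (_ - _).
  rewrite -(sum_eq_op v (fun i => \sum_j (e i j)%:R)).
  apply: eq_bigr => i _; rewrite mulr_sumr; apply: eq_bigr => j _.
  by rewrite mulrC eq_sym.
apply: eq_bigr => i _; rewrite -(sum_eq_op v (fun j => (e i j)%:R)).
by apply: eq_bigr => j _; rewrite mulrC eq_sym.
Qed.

(** Each degree is a sum of incidence vectors over edges. Exchanging sums leaves their scalar
    products, which give the four single coincidences; shared edges give the double one. *)
Lemma comparison_covE e f : comparison_cov e f =
  \sum_p \sum_q (e p.1 p.2)%:R * (f q.1 q.2)%:R *
    (((p.1 == q.1) && (p.2 == q.2))%:R + (p.1 == q.1)%:R + (p.2 == q.2)%:R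
     - (p.1 == q.2)%:R - (p.2 == q.1)%:R).
Proof.
pose incidence (p : 'I_n * 'I_n) v : R := (p.1 == v)%:R - (p.2 == v)%:R.
have incM p q : \sum_v incidence p v * incidence q v =
    (p.1 == q.1)%:R + (p.2 == q.2)%:R - (p.1 == q.2)%:R - (p.2 == q.1)%:R.
  rewrite /incidence; under eq_bigr do rewrite mulrBl.
  rewrite sumrB !sum_eq_op [q.1 == _]eq_sym [q.2 == p.1]eq_sym.
  by rewrite [q.1 == p.2]eq_sym [q.2 == p.2]eq_sym; ring.
rewrite /comparison_cov.
under [X in _ + X]eq_bigr do rewrite !degreeE big_distrlr /=.
rewrite exchange_big /=; under [X in _ + X]eq_bigr do rewrite exchange_big /=.
rewrite /edges pair_bigA /= -big_split /=; apply: eq_bigr => p _.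
have -> : (e p.1 p.2 && f p.1 p.2)%:R =
    \sum_q (e p.1 p.2)%:R * (f q.1 q.2)%:R * ((p.1 == q.1) && (p.2 == q.2))%:R :> R.
  rewrite (bigD1 p)//= !eqxx mulr1 big1 ?addr0 -?natrM ?mulnb//.
  by move=> q qp; rewrite -xpair_eqE -!surjective_pairing eq_sym (negbTE qp) mulr0.
rewrite -big_split /=; apply: eq_bigr => q _.
under [X in _ + X]eq_bigr do rewrite mulrACA.
rewrite -mulr_sumr incM; ring.
Qed.

End comparison_graph.

Section comparison_statistic.
Context (R : realType) (d : measure_display) (T : measurableType d).
Context (P : probability T R) (n : nat) (Z : 'I_n -> {RV P >-> R}).
Hypothesis Ziid : iid_uniform01 Z.

Let gt (p : 'I_n * 'I_n) := [set s | Z p.1 s > Z p.2 s].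

(** The common shape of [X_inv] and [X_des], which are convertible to it for the relations
    [inv_edge] and [des_edge]. *)
Definition comparison_stat (e : 'I_n -> 'I_n -> bool) (t : T) : R :=
  \sum_i \sum_(j | e i j) \1_[set s | Z i s > Z j s] t.

Lemma covariance_comparison_stat (e f : 'I_n -> 'I_n -> bool) :
  (forall i j, e i j -> (i < j)%N) -> (forall i j, f i j -> (i < j)%N) ->
  covariance P (comparison_stat e) (comparison_stat f) =
  (comparison_cov R e f / 12)%:E.
Proof.
have statE g : comparison_stat g = fun t => \sum_p (g p.1 p.2)%:R * \1_(gt p) t.
  apply/funext => t.
  rewrite -(pair_bigA _ (fun i j => (g i j)%:R * \1_(gt (i, j)) t)) /=.
  apply: eq_bigr => i _; rewrite big_mkcond; apply: eq_bigr => j _.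
  by case: (g i j); rewrite ?mul1r ?mul0r.
move=> he hf; have mgt p : measurable (gt p) by exact: measurable_set_ltr.
rewrite !statE covariance_sum_indic// comparison_covE; congr (_%:E).
rewrite mulr_suml; apply: eq_bigr => p _; rewrite mulr_suml; apply: eq_bigr => q _.
case: (boolP (e p.1 p.2)) => [/he lt_p|_]; last by rewrite !mul0r.
case: (boolP (f q.1 q.2)) => [/hf lt_q|_]; last by rewrite !(mulr0, mul0r).
by rewrite (uniform_cov_gt Ziid)// mulrA.
Qed.

End comparison_statistic.

(** * Degrees of the inversion and descent graphs *)

Section descent_graphs.
Context (R : realType) (n : nat).
Implicit Types (k m : nat) (v : 'I_n).

Definition inv_edge k (i j : 'I_n) := ((i < j) && (j - i <= k))%N.
Definition des_edge k (i j : 'I_n) := (j == i + k :> nat)%N.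

(** Degrees and edge counts below are all reduced to the size of such a truncated interval. *)
Lemma card_interval N a b : (\sum_(j < N) (a <= j < b) = minn b N - a)%N.
Proof.
elim: N => [|N IH]; first by rewrite big_ord0; lia.
by rewrite big_ord_recr /= IH; case: (boolP (a <= N < b)%N) => /=; lia.
Qed.

Lemma sum_interval a b : \sum_(j < n) (a <= j < b)%N%:R = (minn b n - a)%:R :> R.
Proof. by rewrite -natr_sum card_interval. Qed.

Lemma inv_outdegree k v :
  \sum_j (inv_edge k v j)%:R = (minn (v + k).+1 n - v.+1)%:R :> R.
Proof.
rewrite -sum_interval; apply: eq_bigr => j _; congr (_%:R).
by rewrite /inv_edge; congr (nat_of_bool _); lia.
Qed.

Lemma inv_indegree k v : \sum_i (inv_edge k i v)%:R = (v - (v - k))%:R :> R.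
Proof.
have -> : (v - (v - k) = minn v n - (v - k))%N by have := ltn_ord v; lia.
rewrite -sum_interval; apply: eq_bigr => i _; congr (_%:R).
by rewrite /inv_edge; congr (nat_of_bool _); lia.
Qed.

Lemma des_outdegree k v : \sum_j (des_edge k v j)%:R = (v + k < n)%N%:R :> R.
Proof.
have -> : ((v + k < n) = minn (v + k).+1 n - (v + k) :> nat)%N by lia.
rewrite -sum_interval; apply: eq_bigr => j _; congr (_%:R).
by rewrite /des_edge; congr (nat_of_bool _); lia.
Qed.

Lemma des_indegree k v : \sum_i (des_edge k i v)%:R = (k <= v)%N%:R :> R.
Proof.
(* The interval is the point [v - k] if [k <= v] and empty otherwise; the extra summand keeps the
   truncated difference 0 from being counted. *)
have -> : ((k <= v) = minn (v - k + (k <= v)) n - (v - k) :> nat)%N.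
  by have := ltn_ord v; lia.
rewrite -sum_interval; apply: eq_bigr => i _; congr (_%:R).
by rewrite /des_edge; congr (nat_of_bool _); lia.
Qed.

Lemma edges_des k : edges R (des_edge k) = (n - k)%:R.
Proof.
rewrite /edges; under eq_bigr do rewrite des_outdegree.
have -> : (n - k = minn (n - k) n - 0)%N by lia.
by rewrite -sum_interval; apply: eq_bigr => i _; congr (_%:R); lia.
Qed.

(** All descent edges have length [m], so either all of them or none are inversion edges. *)
Lemma edges_inv_des k m : (0 < m)%N ->
  edges R (fun i j => inv_edge k i j && des_edge m i j) =
  if (m <= k)%N then (n - m)%:R else 0.
Proof.
move=> m0; case: ifP => mk; last first.
  rewrite /edges big1// => i _; rewrite big1// => j _.
  by rewrite /inv_edge /des_edge (_ : _ && _ = false)//; lia.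
rewrite -edges_des; apply: eq_bigr => i _; apply: eq_bigr => j _; congr (_%:R).
by rewrite /inv_edge /des_edge; congr (nat_of_bool _); lia.
Qed.

Lemma edges_inv_le k : edges R (inv_edge k) <= n%:R * k%:R.
Proof.
rewrite /edges; under eq_bigr do rewrite inv_outdegree.
rewrite -natr_sum -natrM ler_nat.
rewrite (leq_trans (n := \sum_(i < n) k))//; first by apply: leq_sum => i _; lia.
by rewrite sum_nat_const card_ord.
Qed.

(** The first [n - k] vertices have full out-degree [k]. *)
Lemma edges_inv_ge k : (n - k)%:R * k%:R <= edges R (inv_edge k).
Proof.
rewrite /edges; under [leRHS]eq_bigr do rewrite inv_outdegree.
have -> : (n - k = minn (n - k) n - 0)%N by lia.
rewrite -natr_sum -natrM ler_nat -card_interval big_distrl /=.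
by apply: leq_sum => i _; case: (boolP (0 <= i < n - k)%N) => /=; lia.
Qed.

(** A vertex close to both ends is counted twice, so the total is exact even when the two end zones
    overlap. *)
Lemma sum_boundary k : (k <= n)%N ->
  \sum_(v < n) ((v < k)%N%:R + (n - k <= v)%N%:R) = 2 * k%:R :> R.
Proof.
move=> kn; rewrite big_split /=.
have -> : \sum_(v < n) (v < k)%N%:R = k%:R :> R.
  have -> : k%:R = (minn k n - 0)%:R :> R by congr (_%:R); lia.
  by rewrite -sum_interval; apply: eq_bigr => v _; congr (_%:R); lia.
have -> : \sum_(v < n) (n - k <= v)%N%:R = k%:R :> R.
  have -> : k%:R = (minn n n - (n - k))%:R :> R by congr (_%:R); lia.
  rewrite -sum_interval; apply: eq_bigr => v _; congr (_%:R).
  by have := ltn_ord v; lia.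
by ring.
Qed.

(** An interior vertex has [k] successors and [k] predecessors, which cancel. *)
Lemma degree_inv_le k v :
  `|degree R (inv_edge k) v| <= k%:R * ((v < k)%N%:R + (n - k <= v)%N%:R).
Proof.
rewrite /degree inv_outdegree inv_indegree.
rewrite -natrD -natrM distrC.
set a := (X in X%:R - _); set b := (X in _ - X%:R); set c := (X in _ <= X%:R).
have [ac bc] : (a <= b + c)%N /\ (b <= a + c)%N.
  rewrite /a /b /c; have := ltn_ord v.
  case: (ltnP v k) => h1; case: (leqP (n - k) v) => h2 /=; lia.
by rewrite ler_norml; move: ac bc; rewrite -!(ler_nat R) !natrD; lra.
Qed.

Lemma degree_des_le k v :
  `|degree R (des_edge k) v| <= (v < k)%N%:R + (n - k <= v)%N%:R.
Proof.
rewrite /degree des_outdegree des_indegree.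
have -> : (k <= v)%N = ~~ (v < k)%N by lia.
have -> : (v + k < n)%N = ~~ (n - k <= v)%N by have := ltn_ord v; lia.
by case: (v < k)%N; case: (n - k <= v)%N; rewrite /= ler_norml; lra.
Qed.

Lemma degree_des_le1 k v : `|degree R (des_edge k) v| <= 1.
Proof.
rewrite /degree des_outdegree des_indegree.
by case: (v + k < n)%N; case: (k <= v)%N; rewrite /= ler_norml; lra.
Qed.

Lemma degree_inv_le1 k v : `|degree R (inv_edge k) v| <= k%:R.
Proof.
rewrite /degree inv_outdegree inv_indegree.
set a := (X in X%:R - _); set b := (X in _ - X%:R).
have [ac bc] : (a <= k)%N /\ (b <= k)%N by rewrite /a /b; lia.
rewrite ler_norml; move: ac bc; rewrite -!(ler_nat R).
by have := ler0n R a; have := ler0n R b; lra.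
Qed.

(** One factor is at most [k] everywhere, the other at most [k] and supported near the ends, where
    the total weight is [2 * k]. *)
Lemma sum_degree_inv2 k : (k <= n)%N ->
  \sum_v degree R (inv_edge k) v * degree R (inv_edge k) v <= 2 * k%:R ^+ 3.
Proof.
move=> kn; rewrite (_ : 2 * _ = k%:R ^+ 2 * (2 * k%:R)); last by ring.
rewrite -sum_boundary// mulr_sumr; apply: ler_sum => v _.
rewrite (le_trans (ler_norm _))// normrM expr2 -mulrA.
by apply: ler_pM => //; [exact: degree_inv_le1|exact: degree_inv_le].
Qed.

Lemma sum_degree_des2 k : (k <= n)%N ->
  \sum_v degree R (des_edge k) v * degree R (des_edge k) v <= 2 * k%:R.
Proof.
move=> kn; rewrite -sum_boundary//; apply: ler_sum => v _.
rewrite (le_trans (ler_norm _))// normrM -[leRHS]mul1r.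
by apply: ler_pM => //; [exact: degree_des_le1|exact: degree_des_le].
Qed.

(** The inversion degree confines the sum to the ends; the descent degree is at most 1 there,
    whatever [m] is. *)
Lemma sum_degree_inv_des k m : (k <= n)%N ->
  `|\sum_v degree R (inv_edge k) v * degree R (des_edge m) v| <= 2 * k%:R ^+ 2.
Proof.
move=> kn; rewrite (_ : 2 * _ = k%:R * (2 * k%:R)); last by ring.
rewrite -sum_boundary// mulr_sumr (le_trans (ler_norm_sum _ _ _))//.
apply: ler_sum => v _; rewrite normrM -[leRHS]mulr1.
by apply: ler_pM => //; [exact: degree_inv_le|exact: degree_des_le1].
Qed.

End descent_graphs.

(** * The correlation in terms of edge counts and degree sums *)

Section correlation.
Context (R : realType) (n : nat).

(** Twelve times the two variances and the covariance. *)
Definition inv_cov k : R := comparison_cov R (@inv_edge n k) (@inv_edge n k).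
Definition des_cov m : R := comparison_cov R (@des_edge n m) (@des_edge n m).
Definition mix_cov k m : R := comparison_cov R (@inv_edge n k) (@des_edge n m).

Lemma sum_CauchySchwarz (a b : 'I_n -> R) :
  (\sum_v a v * b v) ^+ 2 <= (\sum_v a v * a v) * (\sum_v b v * b v).
Proof.
rewrite -subr_ge0 -(pmulr_rge0 _ (ltr0n R 2)).
set A := \sum_v a v * a v; set B := \sum_v b v * b v; set C := \sum_v a v * b v.
(* Lagrange's identity. *)
have -> : 2 * (A * B - C ^+ 2) = \sum_v \sum_u (a v * b u - a u * b v) ^+ 2.
  rewrite (_ : 2 * _ = A * B + B * A - 2 * (C * C)); last by ring.
  rewrite !big_distrlr /= mulr_sumr -big_split -sumrB /=.
  apply: eq_bigr => v _; rewrite mulr_sumr -big_split -sumrB /=.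
  by apply: eq_bigr => u _; ring.
by apply: sumr_ge0 => v _; apply: sumr_ge0 => u _; exact: sqr_ge0.
Qed.

Lemma edges_andid (e : 'I_n -> 'I_n -> bool) :
  edges R (fun i j => e i j && e i j) = edges R e.
Proof. by apply: eq_bigr => i _; apply: eq_bigr => j _; rewrite andbb. Qed.

Lemma inv_cov_le k : (k <= n)%N -> inv_cov k <= n%:R * k%:R + 2 * k%:R ^+ 3.
Proof.
move=> kn; rewrite /inv_cov /comparison_cov edges_andid.
by rewrite lerD ?edges_inv_le ?sum_degree_inv2.
Qed.

Lemma inv_cov_ge k : (n - k)%:R * k%:R <= inv_cov k.
Proof.
rewrite /inv_cov /comparison_cov edges_andid -[leLHS]addr0.
by rewrite lerD ?edges_inv_ge// sumr_ge0// => v _; rewrite -expr2 sqr_ge0.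
Qed.

Lemma des_cov_le m : (m <= n)%N -> des_cov m <= (n - m)%:R + 2 * m%:R.
Proof.
move=> kn; rewrite /des_cov /comparison_cov edges_andid edges_des.
by rewrite lerD ?sum_degree_des2.
Qed.

Lemma des_cov_ge m : (n - m)%:R <= des_cov m.
Proof.
rewrite /des_cov /comparison_cov edges_andid edges_des lerDl.
by rewrite sumr_ge0// => v _; rewrite -expr2 sqr_ge0.
Qed.

Lemma mix_cov_dist k m : (0 < m <= k)%N -> (k <= n)%N ->
  `|mix_cov k m - (n - m)%:R| <= 2 * k%:R ^+ 2.
Proof.
move=> /andP[m0 mk] kn; rewrite /mix_cov /comparison_cov edges_inv_des// mk.
by rewrite addrAC subrr add0r sum_degree_inv_des.
Qed.

(** With no shared edge only the degree sum remains. Keeping [des_cov m] itself as a factor lets it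
    cancel in the correlation, however large [m] is. *)
Lemma mix_cov_sqr_le k m : (k < m)%N -> (k <= n)%N ->
  mix_cov k m ^+ 2 <= 2 * k%:R ^+ 3 * des_cov m.
Proof.
move=> km kn; have m0 : (0 < m)%N by exact: leq_trans km.
rewrite /mix_cov /comparison_cov edges_inv_des// leqNgt km add0r.
rewrite (le_trans (sum_CauchySchwarz _ _))// ler_pM ?sum_degree_inv2//.
- by rewrite sumr_ge0// => v _; rewrite -expr2 sqr_ge0.
- by rewrite sumr_ge0// => v _; rewrite -expr2 sqr_ge0.
- by rewrite /des_cov /comparison_cov edges_andid edges_des lerDr.
Qed.

Context (d : measure_display) (T : measurableType d).
Context (P : probability T R) (Z : 'I_n -> {RV P >-> R}).
Hypothesis Ziid : iid_uniform01 Z.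

(** The factor 1/12 of the covariance cancels against its square under the root. *)
Lemma Corr_inv_des k m : (0 < m)%N ->
  Corr P (X_inv Z k) (X_des Z m) =
  mix_cov k m / Num.sqrt (inv_cov k * des_cov m).
Proof.
move=> m0.
have hi i j : @inv_edge n k i j -> (i < j)%N by case/andP.
have hd i j : @des_edge n m i j -> (i < j)%N by move=> /eqP ->; lia.
rewrite /Corr /variance.
rewrite -[X_inv Z k]/(comparison_stat Z (@inv_edge n k)).
rewrite -[X_des Z m]/(comparison_stat Z (@des_edge n m)).
rewrite !covariance_comparison_stat//=.
rewrite -/(mix_cov k m) -/(inv_cov k) -/(des_cov m).
have inv0 : 0 <= inv_cov k by rewrite (le_trans _ (inv_cov_ge k))// mulr_ge0.
have des0 : 0 <= des_cov m by rewrite (le_trans _ (des_cov_ge m)).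
rewrite mulrACA -expr2 sqrtrM ?mulr_ge0//.
rewrite sqrtr_sqr ger0_norm ?invr_ge0// invfM invrK mulrA mulrAC divfK//.
Qed.

Lemma Corr_inv_des_sqr_le k m : (0 < k < m)%N -> (m < n)%N -> (k.*2 <= n)%N ->
  Corr P (X_inv Z k) (X_des Z m) ^+ 2 <= 4 * (k%:R ^+ 3 / n%:R).
Proof.
move=> /andP[k0 km] mn kn; rewrite Corr_inv_des//; last exact: leq_trans km.
have n0 : 0 < n%:R :> R by rewrite ltr0n; lia.
have kR : 1 <= k%:R :> R by rewrite ler1n.
have B0 : 0 < des_cov m.
  by apply: lt_le_trans (des_cov_ge m); rewrite ltr0n subn_gt0.
(* As [k] is at most half of [n], the factor [n - k] is at least [n / 2]. *)
have Ak : n%:R * k%:R / 2 <= inv_cov k.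
  apply: le_trans (inv_cov_ge k); rewrite natrB; last by lia.
  move: kn; rewrite -(ler_nat R) -muln2 natrM => kn.
  by rewrite mulrAC ler_wpM2r//; lra.
have nk0 : 0 < n%:R * k%:R / 2 :> R by rewrite !mulr_gt0//; lra.
have A0 : 0 < inv_cov k by exact: lt_le_trans Ak.
have AB0 := mulr_gt0 A0 B0; rewrite expr_div_n sqr_sqrtr ?(ltW AB0)// ler_pdivrMr//.
rewrite [leRHS]mulrA (le_trans (mix_cov_sqr_le km _))//; first by lia.
rewrite ler_pM2r//.
(* Cauchy-Schwarz would give [4 * k ^ 2 / n]; a factor [k >= 1] is given away so that the bound is a
   multiple of [k ^ 3 / n], the null sequence used in every case. *)
apply: le_trans (_ : 4 * (k%:R ^+ 3 / n%:R) * (n%:R * k%:R / 2) <= _);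
  last first.
  by rewrite ler_wpM2l// mulr_ge0// divr_ge0// exprn_ge0.
rewrite (_ : 4 * _ * _ = 2 * k%:R ^+ 3 * k%:R :> R); last by field; rewrite gt_eqF.
by rewrite ler_peMr// mulr_ge0// exprn_ge0.
Qed.

(** Each of the three quantities is divided by its leading term, [n], [n * k] and [n]; what is left
    over is [Num.sqrt k]. *)
Lemma Corr_inv_desE k m : (0 < k <= n)%N -> (0 < m)%N ->
  Corr P (X_inv Z k) (X_des Z m) * Num.sqrt k%:R =
  (mix_cov k m / n%:R) /
    Num.sqrt (inv_cov k / (n%:R * k%:R) * (des_cov m / n%:R)).
Proof.
move=> /andP[k0 kn] m0; rewrite Corr_inv_des//.
have n0 : n%:R != 0 :> R by rewrite pnatr_eq0; lia.
have kR : k%:R != 0 :> R by rewrite pnatr_eq0; lia.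
set x := (X in _ = _ / Num.sqrt X).
have -> : inv_cov k * des_cov m = n%:R ^+ 2 * k%:R * x.
  by rewrite /x; field; rewrite n0.
rewrite sqrtrM ?mulr_ge0// ?sqr_ge0// sqrtrM ?sqr_ge0// sqrtr_sqr ger0_norm//.
rewrite !invfM [X in _ * X * _](_ : _ =
  n%:R^-1 * (Num.sqrt x)^-1 * (Num.sqrt k%:R)^-1); last by ring.
by rewrite !mulrA divfK// sqrtr_eq0 -ltNge lt0r kR ler0n.
Qed.

End correlation.

(** * Relative errors of the normalised variances and covariance *)

Section correlation_rates.
Context (R : realType) (n k m : nat).
Hypotheses (k0 : (0 < k <= n)%N) (mk : (0 < m <= k)%N).

Let n_gt0 : 0 < n%:R :> R.
Proof. by case/andP: k0 => k_gt0 /(leq_trans k_gt0); rewrite ltr0n. Qed.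

Let k_ge1 : 1 <= k%:R :> R. Proof. by rewrite ler1n; case/andP: k0. Qed.

Let m_le_k : m%:R <= k%:R :> R. Proof. by rewrite ler_nat; lia. Qed.

Let k_le_k2 : k%:R <= k%:R ^+ 2 :> R.
Proof. by rewrite expr2 ler_peMr//; have := k_ge1; lra. Qed.

Let k2_le_k3 : k%:R ^+ 2 <= k%:R ^+ 3 :> R.
Proof. by rewrite [leRHS]exprS ler_peMl// exprn_ge0. Qed.

Let dist_div (x y c : R) : 0 < y -> `|x - y| <= c * y -> `|x / y - 1| <= c.
Proof.
move=> y0 xy; rewrite (_ : x / y - 1 = (x - y) / y).
  by rewrite normrM normfV (gtr0_norm y0) ler_pdivrMr.
by rewrite mulrBl divff ?gt_eqF.
Qed.

Lemma inv_cov_rate :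
  `|inv_cov R n k / (n%:R * k%:R) - 1| <= 2 * (k%:R ^+ 3 / n%:R).
Proof.
apply: dist_div; first by rewrite mulr_gt0//; have := k_ge1; lra.
have kn : (k <= n)%N by case/andP: k0.
have := inv_cov_le R kn; have := inv_cov_ge R n k; rewrite natrB//.
rewrite (_ : 2 * _ * _ = 2 * k%:R ^+ 3 * k%:R :> R); last by field; rewrite gt_eqF.
(* After clearing [n * k] the target is [2 * k ^ 4]; this supplies [k ^ 3 <= k ^ 4]. *)
have : 0 <= (k%:R ^+ 3 : R) * (k%:R - 1).
  by rewrite mulr_ge0 ?exprn_ge0//; have := k_ge1; lra.
by have := k_le_k2; have := k2_le_k3; rewrite ler_norml; lra.
Qed.

Lemma des_cov_rate : `|des_cov R n m / n%:R - 1| <= 2 * (k%:R ^+ 3 / n%:R).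
Proof.
apply: dist_div => //; have mn : (m <= n)%N by lia.
have := des_cov_le R mn; have := des_cov_ge R n m; rewrite natrB//.
rewrite -mulrA divfK ?gt_eqF//; have := ler0n R m.
by have := m_le_k; have := k_le_k2; have := k2_le_k3; rewrite ler_norml; lra.
Qed.

(** The constant 3 collects [2 * k ^ 2] from the degrees and the [m <= k] missing edges. *)
Lemma mix_cov_rate : `|mix_cov R n k m / n%:R - 1| <= 3 * (k%:R ^+ 3 / n%:R).
Proof.
apply: dist_div => //; have mn : (m <= n)%N by lia.
have kn : (k <= n)%N by lia.
have := mix_cov_dist R mk kn; rewrite natrB//.
rewrite -mulrA divfK ?gt_eqF//; have := ler0n R m.
by have := m_le_k; have := k_le_k2; have := k2_le_k3; rewrite !ler_norml; lra.
Qed.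

End correlation_rates.

(** * Limits *)

Section limits.
Context (R : realType).

Lemma cube_ratio_cvg0 (d : nat -> nat) :
  (fun n : nat => (d n)%:R : R) =o_\oo
    (fun n : nat => n%:R `^ (1 / 3) * ln (n%:R `^ (4 / 3)) `^ (- (7 / 3)) : R) ->
  ((d n)%:R ^+ 3 / n%:R : R) @[n --> \oo] --> (0 : R).
Proof.
move=> /eqoP dsmall; apply/cvgr0Pnorm_le => eps eps0.
(* Capped at 1 so that [e ^ 3 <= e <= eps] after cubing. *)
pose e := Num.min eps 1.
have e0 : 0 < e by rewrite /e lt_min eps0 ltr01.
have e1 : e <= 1 by rewrite /e ge_min lexx orbT.
have eeps : e <= eps by rewrite /e ge_min lexx.
have /= small := dsmall e e0.
near=> n.
(* Beyond this point the logarithm is at least 1, so its negative power is at most 1 and only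
   [n ^ (1 / 3)] matters. *)
have en : expR 1 < n%:R :> R by near: n; apply: nbhs_infty_gtr.
have dn : `|(d n)%:R : R| <= e * `|n%:R `^ (1 / 3) * ln (n%:R `^ (4 / 3)) `^ (- (7 / 3))|.
  by near: n; exact: small.
have n0 : 0 < n%:R :> R by rewrite (lt_trans _ en)// expR_gt0.
have ln1 : 1 <= ln (n%:R : R).
  by rewrite -[leLHS](expRK 1) ler_ln ?posrE ?expR_gt0// ltW.
have {}dn : (d n)%:R <= e * n%:R `^ (1 / 3) :> R.
  rewrite (le_trans (ler_norm _))// (le_trans dn)// ler_wpM2l//; first exact: ltW.
  rewrite ger0_norm ?mulr_ge0 ?powR_ge0// -[leRHS]mulr1 ler_wpM2l ?powR_ge0//.
  rewrite -[leRHS](powRr0 (ln (n%:R `^ (4 / 3)))) ler_powR//.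
  by rewrite ln_powR; lra.
rewrite ger0_norm ?divr_ge0 ?exprn_ge0// ler_pdivrMr//.
apply: (@le_trans _ _ ((e * n%:R `^ (1 / 3)) ^+ 3)).
  by rewrite lerXn2r ?nnegrE ?mulr_ge0 ?powR_ge0// ltW.
rewrite exprMn -[X in _ * X]powR_mulrn ?powR_ge0// -powRrM divfK ?pnatr_eq0//.
rewrite powRr1 ?(ltW n0)// ler_wpM2r ?(ltW n0)// (le_trans _ eeps)//.
by rewrite exprS ler_piMr ?(ltW e0)// exprn_ile1// ltW.
Unshelve. all: by end_near. Qed.

Lemma inv_sqrt_cvg0 : ((Num.sqrt m%:R)^-1 : R) @[m --> \oo] --> (0 : R).
Proof.
apply/cvgr0Pnorm_le => eps eps0; near=> m.
have m0 : eps^-1 ^+ 2 < m%:R :> R by near: m; apply: nbhs_infty_gtr.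
have e0 : 0 < eps^-1 by rewrite invr_gt0.
have me : eps^-1 <= Num.sqrt m%:R.
  by rewrite -(ger0_norm (ltW e0)) -sqrtr_sqr ler_wsqrtr// ltW.
rewrite ger0_norm ?invr_ge0 ?sqrtr_ge0// -[leRHS]invrK lef_pV2 ?posrE//.
exact: lt_le_trans me.
Unshelve. all: by end_near. Qed.


Lemma cvg_norm_le (f g : nat -> R) (l c : R) :
  (\forall n \near \oo, `|f n - l| <= c * g n) ->
  g n @[n --> \oo] --> (0 : R) -> f n @[n --> \oo] --> l.
Proof.
move=> fg g0.
have cg0 : c * g n @[n --> \oo] --> (0 : R).
  by rewrite -[X in _ --> X](mulr0 c); apply: cvgM => //; exact: cvg_cst.
apply: (@squeeze_cvgr _ _ _ _ (fun n => l - c * g n) (fun n => l + c * g n)).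
- by apply: filterS fg => n; rewrite ler_norml; lra.
- by rewrite -[X in _ --> X]subr0; apply: cvgB => //; exact: cvg_cst.
- by rewrite -[X in _ --> X]addr0; apply: cvgD => //; exact: cvg_cst.
Qed.

Lemma cluster_cvg_unique (u : nat -> R) (l x : R) :
  u n @[n --> \oo] --> l -> cluster (u n @[n --> \oo]) x -> x = l.
Proof.
by move=> ul ux; apply/esym/norm_hausdorff; exact: cvg_cluster ul _ ux.
Qed.

End limits.

(** The range conditions start at [n0] because no admissible value exists for [n <= 1]. Each [n] has
    its own probability space. *)
Theorem theorem3p13 (R : realType)
  (disp : nat -> measure_display) (T : forall n, measurableType (disp n))
  (P : forall n, probability (T n) R)
  (Z : forall n, 'I_n -> {RV (P n) >-> R})
  (Ziid : forall n, iid_uniform01 (Z n))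
  (n0 : nat) (d1 d2 : nat -> nat)
  (hd1 : forall n, (n0 <= n)%N -> (1 <= d1 n <= n - 1)%N)
  (hd2 : forall n, (n0 <= n)%N -> (1 <= d2 n <= n - 1)%N)
  (d1_small : (fun n : nat => (d1 n)%:R : R) =o_\oo
     (fun n : nat => n%:R `^ (1 / 3) * ln (n%:R `^ (4 / 3)) `^ (- (7 / 3)) : R)) :
  let rho_ := fun n : nat =>
    Corr (P n) (X_inv (Z n) (d1 n)) (X_des (Z n) (d2 n)) in
  [/\ (* (a) *)
      (forall n, (n0 <= n)%N -> (d1 n < d2 n)%N) ->
        rho_ n @[n --> \oo] --> (0 : R),
      (* (b), eventually constant case *)
      (forall n, (n0 <= n)%N -> (d2 n <= d1 n)%N) ->
        forall c : nat, (\forall n \near \oo, d1 n = c) ->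
        rho_ n @[n --> \oo] --> (1 / Num.sqrt c%:R : R),
      (* (b), d1 bounded with several accumulation points *)
      (forall n, (n0 <= n)%N -> (d2 n <= d1 n)%N) ->
        (exists M : nat, forall n, (n0 <= n)%N -> (d1 n <= M)%N) ->
        (exists x y : R, [/\ x <> y,
           cluster (((d1 n)%:R : R) @[n --> \oo]) x &
           cluster (((d1 n)%:R : R) @[n --> \oo]) y]) ->
        ~ cvg (rho_ n @[n --> \oo]) &
      (* (c) *)
      (forall n, (n0 <= n)%N -> (d2 n <= d1 n)%N) ->
        d1 n @[n --> \oo] --> \oo ->
        rho_ n @[n --> \oo] --> (0 : R)].
Proof.
move=> rho_.
pose delta n : R := (d1 n)%:R ^+ 3 / n%:R.
have delta0 : delta n @[n --> \oo] --> (0 : R) by exact: cube_ratio_cvg0 d1_small.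
have near_n0 : \forall n \near \oo, (n0 <= n)%N by exact: nbhs_infty_ge.
(* Common to (b) and (c): the three normalised quantities tend to 1, hence so does the correlation
   times [Num.sqrt d1]. *)
have kappa1 : (forall n, (n0 <= n)%N -> (d2 n <= d1 n)%N) ->
    rho_ n * Num.sqrt (d1 n)%:R @[n --> \oo] --> (1 : R).
  move=> d21.
  pose A n := inv_cov R n (d1 n) / (n%:R * (d1 n)%:R).
  pose B n := des_cov R n (d2 n) / n%:R.
  pose C n := mix_cov R n (d1 n) (d2 n) / n%:R.
  have range n : (n0 <= n)%N -> (0 < d1 n <= n)%N /\ (0 < d2 n <= d1 n)%N.
    by move=> nn; have := hd1 n nn; have := hd2 n nn; have := d21 n nn; lia.
  have A1 : A n @[n --> \oo] --> (1 : R).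
    apply: (@cvg_norm_le _ _ delta _ 2) => //.
    by apply: filterS near_n0 => n /range[? ?]; apply: inv_cov_rate.
  have B1 : B n @[n --> \oo] --> (1 : R).
    apply: (@cvg_norm_le _ _ delta _ 2) => //.
    by apply: filterS near_n0 => n /range[? ?]; apply: des_cov_rate.
  have C1 : C n @[n --> \oo] --> (1 : R).
    apply: (@cvg_norm_le _ _ delta _ 3) => //.
    by apply: filterS near_n0 => n /range[? ?]; apply: mix_cov_rate.
  have : C n / Num.sqrt (A n * B n) @[n --> \oo] --> (1 / Num.sqrt (1 * 1) : R).
    apply: cvgM => //; apply: cvgV; first by rewrite mulr1 sqrtr1 oner_neq0.
    have AB1 : A n * B n @[n --> \oo] --> (1 * 1 : R) by exact: cvgM.
    apply: (@cvg_comp _ _ _ (fun n => A n * B n) (@Num.sqrt R) _ _ _ AB1).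
    exact: sqrt_continuous.
  rewrite mulr1 sqrtr1 divr1; apply: cvg_trans; apply: near_eq_cvg.
  apply: filterS near_n0 => n /range[? /andP[? ?]].
  by rewrite /rho_ (Corr_inv_desE (Ziid n)).
have rhoE n : (n0 <= n)%N ->
    rho_ n = rho_ n * Num.sqrt (d1 n)%:R * (Num.sqrt (d1 n)%:R)^-1.
  move=> /hd1 d1n; rewrite mulfK// sqrtr_eq0 -ltNge ltr0n; lia.
split.
- move=> d12.
  have rho2 : rho_ n ^+ 2 @[n --> \oo] --> (0 : R).
    apply: (@cvg_norm_le _ _ delta _ 4) => //.
    near=> n.
    have nn : (n0 <= n)%N by near: n.
    (* Eventually [d1 <= d1 ^ 3 <= n / 2]. *)
    have kn : ((d1 n).*2 <= n)%N.
      have half0 : 0 < 2^-1 :> R by lra.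
      have small : `|delta n| <= 2^-1 by near: n; exact: cvgr0_norm_le.
      have n0R : 0 < n%:R :> R by rewrite ltr0n; have := hd1 n nn; lia.
      have d1R : 1 <= (d1 n)%:R :> R by rewrite ler1n; have := hd1 n nn; lia.
      have cube : (d1 n)%:R <= (d1 n)%:R ^+ 3 :> R.
        by rewrite exprS ler_peMr// expr_ge1.
      move: small; rewrite ger0_norm ?divr_ge0 ?exprn_ge0// ler_pdivrMr// => small.
      by rewrite -(ler_nat R) -muln2 natrM; lra.
    rewrite subr0 ger0_norm ?sqr_ge0// (Corr_inv_des_sqr_le (Ziid n))//.
      by have := hd1 n nn; have := d12 n nn; lia.
    by have := hd1 n nn; have := hd2 n nn; lia.
  apply/cvgr0Pnorm_le => eps eps0.
  have eps2 : 0 < eps ^+ 2 by rewrite exprn_gt0.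
  near=> n.
  have : `|rho_ n ^+ 2| <= eps ^+ 2 by near: n; exact: cvgr0_norm_le.
  by rewrite normrX ler_sqr// nnegrE ltW.
- move=> d21 c d1c.
  have : rho_ n * Num.sqrt (d1 n)%:R * (Num.sqrt c%:R)^-1 @[n --> \oo] -->
      (1 * (Num.sqrt c%:R)^-1 : R) by apply: cvgM; [exact: kappa1|exact: cvg_cst].
  apply: cvg_trans; apply: near_eq_cvg; near=> n.
  have <- : d1 n = c by near: n.
  by rewrite -rhoE//; near: n.
- move=> d21 [M d1M] [x [y [xy clx cly]]] /cvg_ex[l rhol].
  have kappa := kappa1 d21.
  (* If the limit were 0, multiplying by the bounded [Num.sqrt d1] would give 0 instead of 1. *)
  have l0 : l != 0.
    apply/eqP => l0; rewrite l0 in rhol.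
    have : rho_ n * Num.sqrt (d1 n)%:R @[n --> \oo] --> (0 : R).
      apply: (@cvg_norm_le _ _ (fun n => `|rho_ n|) _ (Num.sqrt M%:R)); last first.
        by rewrite -(@normr0 _ R); exact: (cvg_norm rhol).
      apply: filterS near_n0 => n nn; rewrite subr0 normrM mulrC.
      by rewrite (ger0_norm (sqrtr_ge0 _)) ler_wpM2r// ler_wsqrtr// ler_nat d1M.
    move=> /(cvg_unique (@norm_hausdorff _ R^o) kappa) /eqP.
    by rewrite oner_eq0.
  (* This quotient equals [d1 n] eventually, so [d1] would converge to [1 / l ^ 2] and have a single
     accumulation point. *)
  have : (rho_ n * Num.sqrt (d1 n)%:R) ^+ 2 * (rho_ n ^+ 2)^-1 @[n --> \oo] -->
      (1 ^+ 2 * (l ^+ 2)^-1 : R).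
    apply: cvgM; first by rewrite !expr2; exact: cvgM.
    by apply: cvgV; rewrite ?expf_neq0// !expr2; exact: cvgM.
  set l' := (X in _ --> X) => lim.
  have d1l : ((d1 n)%:R : R) @[n --> \oo] --> l'.
    move: lim; apply: cvg_trans; apply: near_eq_cvg; near=> n.
    have rho0 : rho_ n != 0 by near: n; exact: cvgr_neq0 rhol l0.
    by rewrite exprMn sqr_sqrtr// mulrAC divff ?mul1r// expf_neq0.
  by apply: xy; rewrite (cluster_cvg_unique d1l clx) (cluster_cvg_unique d1l cly).
- move=> d21 d1oo.
  have : rho_ n * Num.sqrt (d1 n)%:R * (Num.sqrt (d1 n)%:R)^-1 @[n --> \oo] -->
      (1 * 0 : R).
    apply: cvgM; first exact: kappa1.
    exact: cvg_comp d1oo (@inv_sqrt_cvg0 R).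
  rewrite mul1r; apply: cvg_trans; apply: near_eq_cvg; near=> n.
  by rewrite -rhoE//; near: n.
Unshelve. all: end_near. Qed.
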